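(* Let $n\ge1$ and let $\varpi=(\omega,\eta)\in\Omega^{n+1}(F)$ be a relative pre-$n$-plectic structure on a smooth map $F\colon M\to N$. The projection $p_N\colon\Omega^\bullet(F)\to\Omega^\bullet(N)$, $(\alpha,\beta)\mapsto\alpha$, restricts to a strict $L_\infty$-morphism $L_\infty(F,\varpi)\to L_\infty(N,\omega)$ intertwining all brackets. Moreover, if a Lie group $G$ acts on $F$ preserving $\varpi$, composition with $p_N$ carries relative homotopy moment maps for $(F,\varpi)$ to homotopy moment maps for $(N,\omega)$: if $(f_k)_{1\le k\le n}$ is a relative homotopy moment map, then $(p_N\circ f_k)_{1\le k\le n}$ is a homotopy moment map for the $G$-action on $(N,\omega)$.
   Context: All manifolds, maps, forms and actions are smooth. $\varsigma(k):=-(-1)^{k(k+1)/2}$. For smooth $F\colon M\to N$: $\Omega^k(F)=\Omega^k(N)\oplus\Omega^{k-1}(M)$ (forms of negative degree are $0$), $d_F(\alpha,\beta)=(d\alpha,\,F^*\alpha-d\beta)$. An $F$-pair is a pair $v=(v_N,v_M)$ of vector fields on $N$ and $M$ with $TF\circ v_M=v_N\circ F$; $\iota_v(\alpha,\beta)=(\iota_{v_N}\alpha,-\iota_{v_M}\beta)$, $\mathcal L_v(\alpha,\beta)=(\mathcal L_{v_N}\alpha,\mathcal L_{v_M}\beta)$; $\iota(v_1\wedge\dots\wedge v_k)=\iota_{v_k}\cdots\iota_{v_1}$ (also for ordinary vector fields). A relative pre-$n$-plectic structure is $\varpi=(\omega,\eta)\in\Omega^{n+1}(F)$ with $d_F\varpi=0$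 (so $\omega$ is a closed $(n+1)$-form on $N$). $L_\infty(F,\varpi)=(L,l_k)$: $L^0=\mathrm{Ham}^{n-1}(F,\varpi)$, the space of $\sigma\in\Omega^{n-1}(F)$ admitting an $F$-pair $v_\sigma$ with $d_F\sigma=-\iota_{v_\sigma}\varpi$; $L^{-i}=\Omega^{n-1-i}(F)$ for $1\le i\le n-1$; $l_1=d_F$ on $L^{<0}$, $l_1=0$ on $L^0$; for $k\ge2$, $l_k(\sigma_1,\dots,\sigma_k)=\varsigma(k)\iota(v_{\sigma_1}\wedge\dots\wedge v_{\sigma_k})\varpi$ if all $\sigma_i\in L^0$, and $0$ otherwise. $L_\infty(N,\omega)$ is Rogers' Lie $n$-algebra: the same definition with $\Omega^\bullet(N)$, $d$, vector fields on $N$ and $\omega$ in place of $\Omega^\bullet(F)$, $d_F$, $F$-pairs and $\varpi$. A strict $L_\infty$-morphism is a degree-$0$ linear map $p$ with $p\circ l_k=l_k'\circ p^{\otimes k}$ for all $k\ge1$. An action of $G$ on $F$ is a pair of left actions on $M$ and $N$ making $F$ equivariant; $v_x|_p=\frac{d}{dt}|_{t=0}\exp(-tx)\cdot p$, $v_x=(v_x^N,v_x^M)$; it preserves $\varpi$ if $\mathcal L_{v_x}\varpi=0$ for all $x\in\mathfrak g$. A relative homotopy moment map is an $L_\infty$-morphism $\mathfrak g\rightsquigarrow L_\infty(F,\varpi)$ with $d_Ff_1(x)=-\iota_{v_x}\varpi$; equivalently, linear maps $f_k\colon\Lambda^k\mathfrak g\to\Omega^{n-k}(F)$, $1\le k\le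 n$, with, for $1\le k\le n+1$ ($f_0=f_{n+1}=0$), $\sum_{i<j}(-1)^{i+j+1}f_{k-1}([x_i,x_j],x_1,\dots,\widehat{x_i},\dots,\widehat{x_j},\dots,x_k)=d_Ff_k(x_1,\dots,x_k)+\varsigma(k)\iota(v_{x_1}\wedge\dots\wedge v_{x_k})\varpi$. A homotopy moment map for $(N,\omega)$ is the same notion with $\Omega^\bullet(N)$, $d$, $v_x^N$, $\omega$. *)

(* Defs.v *)
From mathcomp Require Import all_boot all_order all_algebra.
From mathcomp Require Import all_classical all_reals all_analysis.
Set Implicit Arguments.
Unset Strict Implicit.
Unset Printing Implicit Defensive.
Import Order.TTheory GRing.Theory Num.Theory numFieldNormedType.Exports.
Local Open Scope classical_set_scope.
Local Open Scope ring_scope.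

(* Used only for finite-dimensional V, where continuity of all iterated
   directional derivatives on the open set U is the usual C^k. *)

Fixpoint Ck (R : realType) (V W : normedModType R) (k : nat) (U : set V)
    (f : V -> W) : Prop :=
  if k is k'.+1 then
    forall v : V, (forall x, U x -> derivable f x v) /\ Ck k' U ('D_v f)
  else {in U, continuous f}.

Definition smooth_on (R : realType) (V W : normedModType R) (U : set V)
    (f : V -> W) : Prop :=
  forall k, Ck k U f.

Definition smooth_at (R : realType) (V W : normedModType R) (f : V -> W)
    (x : V) : Prop :=
  exists2 U : set V, open_nbhs x U & smooth_on U f.

(* Manifolds: second countable, Hausdorff, of pure finite dimension, without
   boundary, possibly empty. *)

Record chart (R : realType) (M : topologicalType) (m : nat) := Chart {
  chart_dom : set M;
  chart_map :> M -> 'rV[R]_m;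
  chart_inv : 'rV[R]_m -> M;
  chart_dom_open : open chart_dom;
  chart_img_open : open (chart_map @` chart_dom);
  chart_mapK : forall p, chart_dom p -> chart_inv (chart_map p) = p;
  chart_map_continuous : {in chart_dom, continuous chart_map};
  chart_inv_continuous : {in chart_map @` chart_dom, continuous chart_inv}
}.

Record manifold (R : realType) := Manifold {
  mtop :> topologicalType;
  mdim : nat;
  atlas : set (chart R mtop mdim);
  manifold_hausdorff : hausdorff_space mtop;
  manifold_second_countable : @second_countable mtop;
  atlas_cover : forall p : mtop, exists c, atlas c /\ chart_dom c p;
  atlas_compat : forall c c', atlas c -> atlas c' ->
    smooth_on (c @` (chart_dom c `&` chart_dom c')) (c' \o chart_inv c)
}.

Definition chart_at (R : realType) (M : manifold R) (p : M)
    : chart R M (mdim M) :=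
  projT1 (cid (atlas_cover p)).

Definition chartI (R : realType) (M : manifold R) (p : M)
    : 'rV[R]_(mdim M) -> M :=
  chart_inv (chart_at p).

Definition smooth_map (R : realType) (M N : manifold R) (F : M -> N) : Prop :=
  continuous F /\
  forall p, smooth_at (chart_at (F p) \o F \o chartI p) (chart_at p p).

(* Smoothness of a map on the product manifold M1 x M2. *)
Definition smooth_map2 (R : realType) (M1 M2 M3 : manifold R)
    (f : M1 -> M2 -> M3) : Prop :=
  continuous (fun z : M1 * M2 => f z.1 z.2) /\
  forall p q, smooth_at
    (fun z : 'rV[R]_(mdim M1) * 'rV[R]_(mdim M2) =>
       chart_at (f p q) (f (chartI p z.1) (chartI q z.2)))
    (chart_at p p, chart_at q q).

Definition smooth_curve (R : realType) (M : manifold R) (c : R -> M) : Prop :=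
  continuous c /\ forall t, smooth_at (fun s : R => chart_at (c t) (c s)) t.

(* Every tangent space T_pM is 'rV[R]_(mdim M): a tangent vector at p is given
   by its coordinates in the chart [chart_at p]. *)

Definition tspace (R : realType) (M : manifold R) : lmodType R :=
  'rV[R]_(mdim M).

Definition tangent (R : realType) (M N : manifold R) (F : M -> N) (p : M)
    (u : tspace M) : tspace N :=
  'D_u (chart_at (F p) \o F \o chartI p) (chart_at p p).

(* The differential at q of the chart around p, T_qM -> R^m. *)
Definition tchart (R : realType) (M : manifold R) (p q : M) (u : tspace M)
    : 'rV[R]_(mdim M) :=
  'D_u (chart_at p \o chartI q) (chart_at q q).

(* The differential at x of the inverse of the chart around p, with values in
   the tangent space at [chartI p x]. *)
Definition tchartI (R : realType) (M : manifold R) (p : M)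
    (x u : 'rV[R]_(mdim M)) : tspace M :=
  'D_u (chart_at (chartI p x) \o chartI p) x.

Definition velocity (R : realType) (M : manifold R) (c : R -> M) (t : R)
    : tspace M :=
  derive1 (fun s : R => chart_at (c t) (c s) : 'rV[R]_(mdim M)) t.

Definition vfield (R : realType) (M : manifold R) : lmodType R :=
  (M -> tspace M)%type.

Definition vfield_rep (R : realType) (M : manifold R) (v : vfield M) (p : M)
    (x : 'rV[R]_(mdim M)) : 'rV[R]_(mdim M) :=
  tchart p (chartI p x) (v (chartI p x)).

Definition smooth_vfield (R : realType) (M : manifold R) : set (vfield M) :=
  [set v | forall p, smooth_at (vfield_rep v p) (chart_at p p)].

Definition lie_bracket (R : realType) (M : manifold R) (v w : vfield M)
    : vfield M :=
  fun p => 'D_(v p) (vfield_rep w p) (chart_at p p)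
         - 'D_(w p) (vfield_rep v p) (chart_at p p).

(* Differential forms.  A k-linear map is encoded as a function on sequences
   vanishing on those of length other than k, so that forms of all degrees live
   in the single vector space [preform M]; the operations below are defined on
   all of it, and [Omega] cuts out the smooth forms of a given degree. *)

Definition alternating_multilinear (R : realType) (V W : lmodType R) (k : nat)
    (A : seq V -> W) : Prop :=
  [/\ forall s, size s != k -> A s = 0,
      forall s1 s2 a u v, A (s1 ++ (a *: u + v) :: s2)
        = a *: A (s1 ++ u :: s2) + A (s1 ++ v :: s2)
    & forall s1 s2 s3 u, A (s1 ++ u :: s2 ++ u :: s3) = 0].

Definition preform (R : realType) (M : manifold R) : lmodType R :=
  (M -> seq (tspace M) -> R)%type.

(* The pullback of [a] along the inverse of the chart around p. *)
Definition form_rep (R : realType) (M : manifold R) (a : preform M) (p : M)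
    (x : 'rV[R]_(mdim M)) (s : seq 'rV[R]_(mdim M)) : R :=
  a (chartI p x) [seq tchartI p x u | u <- s].

Definition smooth_form (R : realType) (M : manifold R) (a : preform M) : Prop :=
  forall p s, smooth_at (fun x => form_rep a p x s : R^o) (chart_at p p).

Definition Omega (R : realType) (M : manifold R) (k : int)
    : set (preform M) :=
  [set a | if k is Posz j then
             (forall p, alternating_multilinear (W := R^o) j (a p)) /\
             smooth_form a
           else a = 0].

Definition del (T : Type) (i : nat) (s : seq T) : seq T :=
  take i s ++ drop i.+1 s.

(* (da)(u_0,...,u_k) = sum_i (-1)^i D_{u_i} a(u_0,..^u_i..,u_k) for vector
   fields u_i that are constant in the chart around p. *)
Definition extd (R : realType) (M : manifold R) (a : preform M) : preform M :=
  fun p s => \sum_(i < size s)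
    (-1) ^+ i * 'D_(s`_i) (fun x => form_rep a p x (del i s) : R^o)
                          (chart_at p p).

Definition pullback (R : realType) (M N : manifold R) (F : M -> N)
    (a : preform N) : preform M :=
  fun p s => a (F p) [seq tangent F p u | u <- s].

Definition iprod (R : realType) (M : manifold R) (v : vfield M) (a : preform M)
    : preform M :=
  fun p s => a p (v p :: s).

(* [Phi t q] is a smooth flow of v for (t, q) near (0, p). *)
Definition local_flow (R : realType) (M : manifold R) (v : vfield M) (p : M)
    (Phi : R -> M -> M) : Prop :=
  [/\ \forall q \near p, Phi 0 q = q,
      \forall z \near ((0 : R), p),
        velocity (Phi^~ z.2) z.1 = v (Phi z.1 z.2),
      \forall z \near ((0 : R), p),
        {for z, continuous (fun z : R * M => Phi z.1 z.2)}
    & smooth_at (fun z : R * 'rV[R]_(mdim M) =>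
                   chart_at p (Phi z.1 (chartI p z.2))) (0, chart_at p p)].

Definition lie_derivative (R : realType) (M : manifold R) (v : vfield M)
    (a : preform M) : preform M :=
  fun p s =>
    let Phi := xget (T := (R -> M -> M)%type) (fun _ q => q)
                    [set Phi | local_flow v p Phi] in
    derive1 (fun t : R => pullback (Phi t) a p s : R^o) 0.

Record lieGroup (R : realType) := LieGroup {
  lgm :> manifold R;
  lmul : lgm -> lgm -> lgm;
  lone : lgm;
  linv : lgm -> lgm;
  lmulA : associative lmul;
  lmul1 : left_id lone lmul;
  lmulV : left_inverse lone linv lmul;
  lmul_smooth : smooth_map2 lmul;
  linv_smooth : smooth_map linv
}.
Arguments lone {R} _.

Definition lieAlg (R : realType) (G : lieGroup R) : lmodType R := tspace G.

Definition left_invariant (R : realType) (G : lieGroup R) (x : lieAlg G)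
    : vfield G :=
  fun g => tangent (lmul g) (lone G) x.

Definition lieAlg_bracket (R : realType) (G : lieGroup R) (x y : lieAlg G)
    : lieAlg G :=
  lie_bracket (left_invariant x) (left_invariant y) (lone G).

Definition one_parameter_subgroup (R : realType) (G : lieGroup R)
    (x : lieAlg G) (c : R -> G) : Prop :=
  [/\ smooth_curve c, forall s t, c (s + t) = lmul (c s) (c t)
    & velocity c 0 = x].

Definition lieExp (R : realType) (G : lieGroup R) (x : lieAlg G) : G :=
  xget (T := (R -> G)%type) (fun=> lone G)
       [set c | one_parameter_subgroup x c] 1.

Record action (R : realType) (G : lieGroup R) (M : manifold R) := Action {
  act :> G -> M -> M;
  act1 : forall p, act (lone G) p = p;
  actM : forall g h p, act (lmul g h) p = act g (act h p);
  act_smooth : smooth_map2 act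
}.

Definition fund_vfield (R : realType) (G : lieGroup R) (M : manifold R)
    (a : action G M) (x : lieAlg G) : vfield M :=
  fun p => velocity (fun t : R => a (lieExp (- t *: x)) p) 0.

Definition rform (R : realType) (M N : manifold R) : lmodType R :=
  (preform N * preform M)%type.

Definition ROmega (R : realType) (M N : manifold R) (k : int)
    : set (rform M N) :=
  [set a | Omega k a.1 /\ Omega (k - 1) a.2].

Definition rextd (R : realType) (M N : manifold R) (F : M -> N)
    (a : rform M N) : rform M N :=
  (extd a.1, pullback F a.1 - extd a.2).

Definition rvfield (R : realType) (M N : manifold R) : lmodType R :=
  (vfield N * vfield M)%type.

Definition Fpair (R : realType) (M N : manifold R) (F : M -> N)
    : set (rvfield M N) :=
  [set v | [/\ smooth_vfield v.1, smooth_vfield v.2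
             & forall p, tangent F p (v.2 p) = v.1 (F p)]].

Definition riprod (R : realType) (M N : manifold R) (v : rvfield M N)
    (a : rform M N) : rform M N :=
  (iprod v.1 a.1, - iprod v.2 a.2).

Definition rlie_derivative (R : realType) (M N : manifold R) (v : rvfield M N)
    (a : rform M N) : rform M N :=
  (lie_derivative v.1 a.1, lie_derivative v.2 a.2).

Definition relative_pre_nplectic (R : realType) (M N : manifold R)
    (F : M -> N) (n : nat) (w : rform M N) : Prop :=
  ROmega (n%:Z + 1) w /\ rextd F w = 0.

Definition pN (R : realType) (M N : manifold R) (a : rform M N) : preform N :=
  a.1.

(* L-infinity data: graded pieces of an ambient vector space, and for each k
   the value l_k(s_1,...,s_k) on homogeneous s_j in L^{i_j}, as a function of
   both the degrees i_j and the elements s_j. *)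

Record Linf_data (R : realType) (V : lmodType R) := LinfData {
  Lcomp : int -> set V;
  Lbr : seq int -> seq V -> V
}.

Definition strict_morphism (R : realType) (V V' : lmodType R)
    (L : Linf_data V) (L' : Linf_data V') (p : V -> V') : Prop :=
  [/\ linear p,
      forall i s, Lcomp L i s -> Lcomp L' i (p s)
    & forall k (i : k.-tuple int) (s : k.-tuple V), (1 <= k)%N ->
        (forall j, Lcomp L (tnth i j) (tnth s j)) ->
        p (Lbr L i s) = Lbr L' i (map p s)].

Definition varsigma (R : realType) (k : nat) : R :=
  - (-1) ^+ (k * k.+1)./2.

(* The constructions common to (Omega(F), d_F, F-pairs) and (Omega(N), d, vector
   fields on N): [Om], [D] are the complex, [X] the admissible vector fields,
   [io] the contraction. *)
Section Generic.
Context {R : realType} {V X : lmodType R}.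
Variables (Om : int -> set V) (D : V -> V) (adm : set X) (io : X -> V -> V).

Definition contr (vs : seq X) (w : V) : V :=
  foldl (fun a v => io v a) w vs.

Definition is_ham_vfield (w s : V) : set X :=
  [set v | adm v /\ D s = - io v w].

Definition Ham (n : nat) (w : V) : set V :=
  [set s | Om (n%:Z - 1) s /\ exists v, is_ham_vfield w s v].

Definition ham_vfield (w s : V) : X := xget 0 (is_ham_vfield w s).

Definition Linf_comp (n : nat) (w : V) (i : int) : set V :=
  if i == 0 then Ham n w
  else if (1 - n%:Z <= i) && (i < 0) then Om (n%:Z - 1 + i)
  else [set 0].

Definition Linf_br (w : V) (i : seq int) (s : seq V) : V :=
  match i, s with
  | [:: i1], [:: s1] => if i1 < 0 then D s1 else 0
  | _, _ => if all (pred1 0) i then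
              varsigma R (size s) *: contr (map (ham_vfield w) s) w
            else 0
  end.

Definition Linf_of (n : nat) (w : V) : Linf_data V :=
  LinfData (Linf_comp n w) (Linf_br w).

(* Linear maps Lambda^k g -> Omega^{n-k} are alternating k-linear maps.  The
   indices i < j are 0-based, which leaves (-1)^(i+j+1) unchanged. *)
Definition hmm_of (G : lieGroup R) (n : nat) (w : V) (vx : lieAlg G -> X)
    (f : nat -> seq (lieAlg G) -> V) : Prop :=
  let f' k := if (1 <= k <= n)%N then f k else fun=> 0 in
  (forall k, (1 <= k <= n)%N ->
     alternating_multilinear k (f k) /\ forall x, Om (n%:Z - k%:Z) (f k x)) /\
  (forall k (x : k.-tuple (lieAlg G)), (1 <= k <= n.+1)%N ->
     \sum_(j < k) \sum_(i < j)
        (-1) ^+ (i + j + 1) *: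
        f' k.-1 (lieAlg_bracket (nth 0 x i) (nth 0 x j) :: del i (del j x))
     = D (f' k x) + varsigma R k *: contr (map vx x) w).

End Generic.

Definition Linf (R : realType) (N : manifold R) (n : nat) (w : preform N)
    : Linf_data (preform N) :=
  Linf_of (@Omega R N) (@extd R N) (@smooth_vfield R N) (@iprod R N) n w.

Definition rLinf (R : realType) (M N : manifold R) (F : M -> N) (n : nat)
    (w : rform M N) : Linf_data (rform M N) :=
  Linf_of (@ROmega R M N) (rextd F) (Fpair F) (@riprod R M N) n w.

Definition homotopy_moment_map (R : realType) (G : lieGroup R)
    (N : manifold R) (aN : action G N) (n : nat) (w : preform N)
    (f : nat -> seq (lieAlg G) -> preform N) : Prop :=
  hmm_of (@Omega R N) (@extd R N) (@iprod R N) n w (fund_vfield aN) f.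

Definition rfund_vfield (R : realType) (G : lieGroup R) (M N : manifold R)
    (aM : action G M) (aN : action G N) (x : lieAlg G) : rvfield M N :=
  (fund_vfield aN x, fund_vfield aM x).

Definition relative_homotopy_moment_map (R : realType) (G : lieGroup R)
    (M N : manifold R) (F : M -> N) (aM : action G M) (aN : action G N)
    (n : nat) (w : rform M N) (f : nat -> seq (lieAlg G) -> rform M N)
    : Prop :=
  hmm_of (@ROmega R M N) (rextd F) (@riprod R M N) n w (rfund_vfield aM aN) f.

Definition equivariant (R : realType) (G : lieGroup R) (M N : manifold R)
    (F : M -> N) (aM : action G M) (aN : action G N) : Prop :=
  forall g p, F (aM g p) = aN g (F p).

Definition preserves (R : realType) (G : lieGroup R) (M N : manifold R)
    (aM : action G M) (aN : action G N) (w : rform M N) : Prop :=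
  forall x, rlie_derivative (rfund_vfield aM aN x) w = 0.

(* Main.v *)
Require Import Defs.
From mathcomp Require Import all_boot all_order all_algebra.
From mathcomp Require Import all_classical all_reals all_analysis.
Import GRing.Theory.

(** The projection commutes with all operations entering the definitions, so
    both claims hold componentwise, except that the brackets on both sides are
    computed with independently chosen Hamiltonian vector fields.  If
    [v_sigma = (v_N, v_M)] is the chosen F-pair of [sigma], then [v_N] is a
    Hamiltonian vector field of [pN sigma], so it differs from the chosen one
    by an element of the kernel of [omega]; as [omega] is alternating, such a
    difference does not change the contractions. *)

Local Open Scope ring_scope.

(** Polarization between the slot of [u] and the first slot: if [v] is the first entry, the value
    with [u + v] in both slots is 0. In its expansion the terms with [u] in front vanish by
    hypothesis, and the one with [v] twice by alternation. *)
Lemma alternating_multilinear_ker {R : realType} {V W : lmodType R} {k : nat}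
    {A : seq V -> W} (hA : alternating_multilinear k A) (u : V) :
  (forall s, A (u :: s) = 0) -> forall s1 s2, A (s1 ++ u :: s2) = 0.
Proof.
case: hA => _ linA altA u0 [|v s1] s2 //=.
have := altA [::] s1 s2 (1 *: u + v).
rewrite (linA [::] _ 1 u v) /= u0 scaler0 add0r.
rewrite -!cat_cons (linA (v :: s1) s2 1 u v) scale1r.
by have /= -> := altA [::] s1 s2 v; rewrite addr0.
Qed.

Lemma alternating_multilinear_eq {R : realType} {V W : lmodType R} {k : nat}
    {A : seq V -> W} (hA : alternating_multilinear k A) (u v : V) :
  (forall s, A (u :: s) = A (v :: s)) ->
  forall s1 s2, A (s1 ++ u :: s2) = A (s1 ++ v :: s2).
Proof.
move=> uv s1 s2; have [_ linA _] := hA.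
(* [-1 *: v + u] is [u - v] in the shape that the linearity clause takes; the kernel lemma is
   applied to this difference. *)
have linB t1 t2 : A (t1 ++ (-1 *: v + u) :: t2)
    = A (t1 ++ u :: t2) - A (t1 ++ v :: t2).
  by rewrite linA scaleN1r addrC.
apply/eqP; rewrite -subr_eq0 -linB; apply/eqP.
apply: (alternating_multilinear_ker hA) => s.
by rewrite (linB [::] s) /= uv subrr.
Qed.

Lemma contr_iprodE {R : realType} {N : manifold R} (vs : seq (vfield N))
    (w : preform N) p s :
  contr (@iprod R N) vs w p s = w p ([seq v p | v <- vs] ++ s).
Proof. by elim: vs w s => //= v vs IH w s; rewrite IH. Qed.

Lemma contr_riprod1 {R : realType} {M N : manifold R} (vs : seq (rvfield M N))
    (w : rform M N) :
  (contr (@riprod R M N) vs w).1 = contr (@iprod R N) [seq v.1 | v <- vs] w.1.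
Proof. by elim: vs w => //= v vs IH w; rewrite IH. Qed.

Lemma eq_contr_iprod {R : realType} {N : manifold R} {T : eqType} {k : nat}
    {w : preform N} (hw : forall p, alternating_multilinear (W := R^o) k (w p))
    (v v' : T -> vfield N) (ts : seq T) :
  {in ts, forall t, iprod (v t) w = iprod (v' t) w} ->
  contr (@iprod R N) (map v ts) w = contr (@iprod R N) (map v' ts) w.
Proof.
move=> vv'; apply/funext => p; apply/funext => s; rewrite !contr_iprodE.
(* The explicit empty prefix is generalized in the induction to the list [s1] of arguments already
   exchanged, so that one slot changes at a time. *)
rewrite -[LHS]/(w p ([::] ++ _)) -[RHS]/(w p ([::] ++ _)).
elim: ts vv' [::] => //= t ts IH vv' s1.
have wt s' : w p (v t p :: s') = w p (v' t p :: s').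
  by rewrite -[LHS]/(iprod (v t) w p s') vv' ?mem_head.
rewrite (alternating_multilinear_eq (hw p) _ _ wt) -!cat_rcons.
by apply: IH => t' ht'; apply: vv'; rewrite inE ht' orbT.
Qed.

Lemma is_ham_vfield_pN {R : realType} {M N : manifold R} {F : M -> N}
    {w s : rform M N} {v : rvfield M N} :
  is_ham_vfield (rextd F) (Fpair F) (@riprod R M N) w s v ->
  is_ham_vfield (@extd R N) (@smooth_vfield R N) (@iprod R N) w.1 (pN s) v.1.
Proof. by case=> [[sv _ _]] /(congr1 fst) /= ds; split. Qed.

(** Both sides equal [- extd (pN s)]. Since [s] is Hamiltonian, neither choice made by [xget] falls
    back to the default 0. *)
Lemma iprod_ham_vfield_pN {R : realType} {M N : manifold R} {F : M -> N}
    {n : nat} {w s : rform M N} :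
  Ham (@ROmega R M N) (rextd F) (Fpair F) (@riprod R M N) n w s ->
  iprod (ham_vfield (rextd F) (Fpair F) (@riprod R M N) w s).1 w.1 =
  iprod (ham_vfield (@extd R N) (@smooth_vfield R N) (@iprod R N) w.1 (pN s))
    w.1.
Proof.
case=> _ hs.
have /is_ham_vfield_pN hv := xgetPex 0 hs.
(* The [N]-component of the chosen F-pair witnesses that [pN s] has a Hamiltonian vector field. *)
have [_ dv'] := xgetPex 0 (ex_intro _ _ hv).
by case: hv => _ dv; apply: oppr_inj; rewrite -[LHS]dv -[RHS]dv'.
Qed.

Lemma Linf_comp_pN {R : realType} {M N : manifold R} {F : M -> N} {n : nat}
    {w : rform M N} (i : int) (s : rform M N) :
  Lcomp (rLinf F n w) i s -> Lcomp (Linf n w.1) i (pN s).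
Proof.
rewrite /= /Linf_comp; case: ifP => _.
  by case=> [[Os _] [v /is_ham_vfield_pN hv]]; split=> //; exists v.1.
by case: ifP => _ [] // ->.
Qed.

Lemma pN_linear {R : realType} {M N : manifold R} : linear (@pN R M N).
Proof. exact: (linearP fst). Qed.

Lemma pNZ {R : realType} {M N : manifold R} (a : R) (s : rform M N) :
  pN (a *: s) = a *: pN s.
Proof. exact: (linearZ_LR fst). Qed.

Lemma contr_ham_vfield_pN {R : realType} {M N : manifold R} {F : M -> N}
    {n : nat} {w : rform M N} (ss : seq (rform M N)) :
  ROmega (n%:Z + 1) w ->
  {in ss, forall s, Ham (@ROmega R M N) (rextd F) (Fpair F) (@riprod R M N)
    n w s} ->
  pN (contr (@riprod R M N)
    (map (ham_vfield (rextd F) (Fpair F) (@riprod R M N) w) ss) w) =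
  contr (@iprod R N)
    (map (ham_vfield (@extd R N) (@smooth_vfield R N) (@iprod R N) w.1)
      (map (@pN R M N) ss)) w.1.
Proof.
case=> [[altw _] _] hss; rewrite /pN contr_riprod1 -!map_comp.
by apply: (eq_contr_iprod altw) => s /hss /iprod_ham_vfield_pN.
Qed.

(** Turns the [match] into a test on [size s], which [map] preserves, so that the brackets of [s]
    and of its projection take the same branch. *)
Lemma Linf_brE {R : realType} {V X : lmodType R} (D : V -> V) (adm : set X)
    (io : X -> V -> V) (w : V) (i : seq int) (s : seq V) :
  size i = size s -> (1 <= size s)%N ->
  Linf_br D adm io w i s =
  if size s == 1%N then if head 0 i < 0 then D (head 0 s) else 0
  else if all (pred1 0) i
    then varsigma R (size s) *: contr io (map (ham_vfield D adm io w) s) w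
  else 0.
Proof. by case: i s => [|i1 [|i2 i]] [|s1 [|s2 s]]. Qed.

Lemma Linf_br_pN {R : realType} {M N : manifold R} {F : M -> N} {n : nat}
    {w : rform M N} (i : seq int) (s : seq (rform M N)) :
  ROmega (n%:Z + 1) w -> size i = size s -> (1 <= size s)%N ->
  (all (pred1 0) i -> {in s, forall t,
    Ham (@ROmega R M N) (rextd F) (Fpair F) (@riprod R M N) n w t}) ->
  pN (Lbr (rLinf F n w) i s) = Lbr (Linf n w.1) i (map (@pN R M N) s).
Proof.
move=> hw sz s0 hs; rewrite /= !Linf_brE ?size_map //.
case: ifP => _; first by case: s s0 {sz hs} => // s1 s _ /=; case: ifP.
by case: ifP => [/hs hs'|_]; first rewrite -(contr_ham_vfield_pN _ hw hs') pNZ.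
Qed.

Lemma strict_morphism_pN {R : realType} {M N : manifold R} {F : M -> N}
    {n : nat} {w : rform M N} :
  ROmega (n%:Z + 1) w -> strict_morphism (rLinf F n w) (Linf n w.1) (@pN R M N).
Proof.
move=> hw; split; [exact: pN_linear | exact: Linf_comp_pN |].
move=> k i s k0 hs; apply: Linf_br_pN; rewrite ?size_tuple //.
(* The graded piece of degree 0 is [Ham] by definition. *)
move=> /all_tnthP i0 t /tnthP [j ->].
by have := hs j; rewrite (eqP (i0 j)).
Qed.

(** The contracted fields are now the fundamental ones, and those on [N] are the first components of
    the relative ones; the required equation is thus the first component of the given one. *)
Lemma homotopy_moment_map_pN {R : realType} {M N : manifold R} {F : M -> N}
    {G : lieGroup R} {aM : action G M} {aN : action G N} {n : nat}
    {w : rform M N} {f : nat -> seq (lieAlg G) -> rform M N} :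
  relative_homotopy_moment_map F aM aN n w f ->
  homotopy_moment_map aN n w.1 (fun k x => pN (f k x)).
Proof.
case=> hf eqf; split=> [k hk|k x hk].
  have [[f0 flin falt] fO] := hf k hk.
  split; last by move=> x; have [] := fO x.
  split=> [s /f0 -> //|s1 s2 a u v|s1 s2 s3 u]; last by rewrite falt.
  by rewrite flin pN_linear.
(* Projection respects the convention that [f] is 0 at the indices 0 and [n.+1]. *)
have f'E j y : (if (1 <= j <= n)%N then fun x => pN (f j x) else fun=> 0) y
    = ((if (1 <= j <= n)%N then f j else fun=> 0) y).1 by case: ifP.
have := congr1 fst (eqf k x hk); rewrite /= contr_riprod1 -map_comp f'E => <-.
rewrite (raddf_sum fst); apply: eq_bigr => j _.
rewrite (raddf_sum fst); apply: eq_bigr => i _.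
by rewrite -[RHS]/(pN _) pNZ f'E.
Qed.

Theorem corollary5p6 (R : realType) (M N : manifold R) (F : M -> N)
    (hF : smooth_map F) (n : nat) (hn : (1 <= n)%N)
    (omega : preform N) (eta : preform M)
    (hw : relative_pre_nplectic F n (omega, eta)) :
  strict_morphism (rLinf F n (omega, eta)) (Linf n omega) (@pN R M N) /\
  forall (G : lieGroup R) (aM : action G M) (aN : action G N),
    equivariant F aM aN ->
    preserves aM aN (omega, eta) ->
    forall f : nat -> seq (lieAlg G) -> rform M N,
      relative_homotopy_moment_map F aM aN n (omega, eta) f ->
      homotopy_moment_map aN n omega (fun k x => pN (f k x)).
Proof.
split; first exact: strict_morphism_pN hw.1.
by move=> G aM aN _ _ f /homotopy_moment_map_pN.
Qed.
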